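(* Let $P$ be a program over a set of atoms $\mathcal{A}$ and let $x$ be a literal such that, if $x$ occurs in $P$ at all, every occurrence of $x$ in $P$ is under the scope of the symbol $\lnot$. Let $F$ be a formula over a set of atoms $\mathcal{F}$ with $Lit_{\mathcal{F}} \subseteq Lit_{\mathcal{A}}$ and $x \notin Lit_{\mathcal{F}}$. Then $P \cup \{x \leftarrow F\}$ and $P \cup \{x \leftrightarrow F\}$ have exactly the same answer sets.
   Context: Formulas are built from atoms using $\wedge,\vee,\rightarrow,\bot$ and the unary strong negation $\sim$; $\lnot F$ abbreviates $F\rightarrow\bot$, $\top$ abbreviates $\bot\rightarrow\bot$, $F\leftrightarrow G$ abbreviates $(F\rightarrow G)\wedge(G\rightarrow F)$, and $x\leftarrow F$ is the formula $F\rightarrow x$. $\mathrm{N}_2$ is the propositional logic obtained from intuitionistic logic by adding the Nelson strong-negation axioms $\sim(\alpha\rightarrow\beta)\leftrightarrow\alpha\wedge\sim\beta$, $\sim(\alpha\wedge\beta)\leftrightarrow\sim\alpha\vee\sim\beta$, $\sim(\alpha\vee\beta)\leftrightarrow\sim\alpha\wedge\sim\beta$, $\alpha\leftrightarrow\sim\sim\alpha$, $\sim\lnot\alpha\leftrightarrow\alpha$, $\sim a\rightarrow\lnot a$ ($a$ atomic), together with the schema $\alpha\vee(\alpha\rightarrow\beta)\vee\lnot\beta$; $\vdash_{N_2}$ is its derivability. A literal is an atom $a$ or $\sim a$; $Lit_{\mathcal{A}}=\mathcal{A}\cup\{\sim a: a\in\mathcal{A}\}$. A literal $l$ occurs in a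 literal $l$, and occurs in a compound formula iff it occurs in one of its immediate subformulas (so $a$ does not occur in $\sim a$ and vice versa); an occurrence is under the scope of $\lnot$ if it lies inside a subformula of the form $\lnot G$. A program is a finite set of formulas of the form $G\rightarrow l$ with $l$ a literal and $G$ built from literals, $\top,\bot$ by $\wedge,\vee,\lnot$. A set of literals is consistent if it does not contain both $a$ and $\sim a$ for any atom $a$. For a finite set of formulas $T$ over atoms $\mathcal{A}$ and a consistent $M\subseteq Lit_{\mathcal{A}}$, write $\widetilde{M}=Lit_{\mathcal{A}}\setminus M$; $M$ is an answer set of $T$ iff $T\cup\{\lnot l: l\in\widetilde M\}\cup\{\lnot\lnot l: l\in M\}$ is consistent in $\mathrm{N}_2$ and derives in $\mathrm{N}_2$ every literal of $M$. *)

(* Defs.v *)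
From mathcomp Require Import all_boot.
From mathcomp Require Import classical_sets cardinality.

Set Implicit Arguments.
Unset Strict Implicit.
Unset Printing Implicit Defensive.

Local Open Scope classical_set_scope.

Inductive formula (V : Type) : Type :=
| Atom (a : V)
| Bot
| And (f g : formula V)
| Or (f g : formula V)
| Imp (f g : formula V)
| SNeg (f : formula V). (* strong negation ~ *)

Arguments Bot {V}.

Definition Neg (V : Type) (f : formula V) : formula V := Imp f Bot.
Definition Top (V : Type) : formula V := Imp Bot Bot.
Arguments Top {V}.
Definition Iff (V : Type) (f g : formula V) : formula V :=
  And (Imp f g) (Imp g f).

Fixpoint atoms (V : Type) (f : formula V) : set V :=
  match f with
  | Atom a => [set a]
  | Bot => set0
  | And g h | Or g h | Imp g h => atoms g `|` atoms h
  | SNeg g => atoms g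
  end.

Definition over_atoms (V : Type) (A : set V) (T : set (formula V)) : Prop :=
  forall f, T f -> atoms f `<=` A.

(* Literals are formulas. *)
Definition Lit (V : Type) (A : set V) : set (formula V) :=
  [set l | exists2 a, A a & l = Atom a \/ l = SNeg (Atom a)].

Definition literal (V : Type) : set (formula V) := Lit setT.

Definition consistent_lits (V : Type) (M : set (formula V)) : Prop :=
  forall a, ~ (M (Atom a) /\ M (SNeg (Atom a))).

Inductive N2_axiom (V : Type) : formula V -> Prop :=
(* intuitionistic propositional logic *)
| ax_K f g : N2_axiom (Imp f (Imp g f))
| ax_S f g h :
    N2_axiom (Imp (Imp f (Imp g h)) (Imp (Imp f g) (Imp f h)))
| ax_andl f g : N2_axiom (Imp (And f g) f)
| ax_andr f g : N2_axiom (Imp (And f g) g)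
| ax_andI f g : N2_axiom (Imp f (Imp g (And f g)))
| ax_orl f g : N2_axiom (Imp f (Or f g))
| ax_orr f g : N2_axiom (Imp g (Or f g))
| ax_orE f g h :
    N2_axiom (Imp (Imp f h) (Imp (Imp g h) (Imp (Or f g) h)))
| ax_bot f : N2_axiom (Imp Bot f)
(* Nelson's axioms for strong negation *)
| ax_snImp f g : N2_axiom (Iff (SNeg (Imp f g)) (And f (SNeg g)))
| ax_snAnd f g : N2_axiom (Iff (SNeg (And f g)) (Or (SNeg f) (SNeg g)))
| ax_snOr f g : N2_axiom (Iff (SNeg (Or f g)) (And (SNeg f) (SNeg g)))
| ax_snSNeg f : N2_axiom (Iff f (SNeg (SNeg f)))
| ax_snNeg f : N2_axiom (Iff (SNeg (Neg f)) f)
| ax_snAtom a : N2_axiom (Imp (SNeg (Atom a)) (Neg (Atom a)))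
(* here-and-there *)
| ax_HT f g : N2_axiom (Or f (Or (Imp f g) (Neg g))).

Inductive N2_derives (V : Type) (T : set (formula V)) : formula V -> Prop :=
| N2_hyp f : T f -> N2_derives T f
| N2_ax f : N2_axiom f -> N2_derives T f
| N2_mp f g : N2_derives T (Imp f g) -> N2_derives T f -> N2_derives T g.

Definition N2_consistent (V : Type) (T : set (formula V)) : Prop :=
  ~ N2_derives T Bot.

(* A literal counts as a leaf: the atom a is not an immediate subformula of
   the literal ~ a. *)
Definition immediate_subformulas (V : Type) (f : formula V) :
    seq (formula V) :=
  match f with
  | Atom _ | Bot | SNeg (Atom _) => [::]
  | And g h | Or g h | Imp g h => [:: g; h]
  | SNeg g => [:: g]
  end.

(* The subformula of f at position p, a path of child indices from the root. *)
Fixpoint subformula_at (V : Type) (f : formula V) (p : seq nat) :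
    option (formula V) :=
  if p is i :: q then
    if onth (immediate_subformulas f) i is Some g then subformula_at g q
    else None
  else Some f.

Definition occurrence (V : Type) (l f : formula V) (p : seq nat) : Prop :=
  subformula_at f p = Some l.

Definition under_neg (V : Type) (f : formula V) (p : seq nat) : Prop :=
  exists q G, prefix q p /\ subformula_at f q = Some (Neg G).

Inductive body (V : Type) : formula V -> Prop :=
| body_lit l : literal l -> body l
| body_top : body Top
| body_bot : body Bot
| body_and f g : body f -> body g -> body (And f g)
| body_or f g : body f -> body g -> body (Or f g)
| body_neg f : body f -> body (Neg f).

Definition program (V : Type) (P : set (formula V)) : Prop :=
  finite_set P /\
  forall f, P f -> exists G l, [/\ body G, literal l & f = Imp G l].

Definition completion (V : Type) (A : set V) (T M : set (formula V)) :
    set (formula V) :=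
  T `|` [set Neg l | l in Lit A `\` M] `|` [set Neg (Neg l) | l in M].

(* Intended for T finite and over A. *)
Definition answer_set (V : Type) (A : set V) (T M : set (formula V)) : Prop :=
  [/\ M `<=` Lit A, consistent_lits M,
      N2_consistent (completion A T M) &
      forall l, M l -> N2_derives (completion A T M) l].

(* Main.v *)
(* Semantically, M is an answer set of T iff (M, M) is the only here-and-there
   model (H, M) of T with H included in M.  If M is an answer set of
   P + (x <- F) and x is in M, then (M, M) satisfies F: otherwise (M \ {x}, M)
   would be another model, because no rule of P has head x.  The converse is
   syntactic and needs no completeness theorem: when x is in M, the completion
   of P + (x <- F) proves both the double negation of x and that of F, hence
   does not distinguish them inside the scope of a negation, and substituting F
   for x turns a derivation from the completion of P + (x <-> F) into one from
   the completion of P + (x <- F). *)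
Require Import Defs.
From mathcomp Require Import all_boot.
From mathcomp Require Import boolp classical_sets cardinality.

Local Open Scope classical_set_scope.

Local Notation "T |-- f" := (N2_derives T f) (at level 70, no associativity).

Ltac hyp := solve [assumption | apply: N2_hyp; repeat (first [by right | left])].

(** * Derivability in N2 *)

Lemma derives_cut (V : Type) (S T : set (formula V)) f :
  (forall h, S h -> T |-- h) -> S |-- f -> T |-- f.
Proof.
move=> ST; elim=> [h /ST//|h ax_h|h g _ IHhg _ IHh]; first exact: N2_ax.
exact: N2_mp IHhg IHh.
Qed.

Lemma derives_sub (V : Type) (S T : set (formula V)) f :
  S `<=` T -> S |-- f -> T |-- f.
Proof. by move=> ST; apply: derives_cut => h /ST; apply: N2_hyp. Qed.

Lemma derives_U1 (V : Type) (T : set (formula V)) f g :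
  T |-- f -> T `|` [set g] |-- f.
Proof. by apply: derives_sub => h; left. Qed.

Lemma imp_refl (V : Type) (T : set (formula V)) f : T |-- Imp f f.
Proof.
apply: N2_mp (N2_ax _ (ax_K f f)).
by apply: N2_mp (N2_ax _ (ax_K f (Imp f f))); apply: N2_ax; constructor.
Qed.

Lemma imp_const (V : Type) (T : set (formula V)) f g : T |-- g -> T |-- Imp f g.
Proof. by apply: N2_mp; apply: N2_ax; constructor. Qed.

Lemma deduction (V : Type) (T : set (formula V)) f g :
  T `|` [set f] |-- g -> T |-- Imp f g.
Proof.
elim=> [h [Th|->]|h ax_h|h k _ IHhk _ IHh].
- exact/imp_const/N2_hyp.
- exact: imp_refl.
- exact/imp_const/N2_ax.
- apply: N2_mp IHh; apply: N2_mp IHhk; apply: N2_ax; constructor.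
Qed.

Lemma imp_mp (V : Type) (T : set (formula V)) f g :
  T |-- Imp f g -> T `|` [set f] |-- g.
Proof. by move=> fg; apply: (@N2_mp _ _ f); [exact: derives_U1|hyp]. Qed.

Lemma imp_trans (V : Type) (T : set (formula V)) f g h :
  T |-- Imp f g -> T |-- Imp g h -> T |-- Imp f h.
Proof.
by move=> fg gh; apply: deduction; apply: N2_mp (derives_U1 _ _ _ _ gh) (imp_mp _ _ _ _ fg).
Qed.

Lemma andI (V : Type) (T : set (formula V)) f g :
  T |-- f -> T |-- g -> T |-- And f g.
Proof.
by move=> Tf; apply: N2_mp; apply: N2_mp Tf; apply: N2_ax; constructor.
Qed.

Lemma andEl (V : Type) (T : set (formula V)) f g : T |-- And f g -> T |-- f.
Proof. by apply: N2_mp; apply: N2_ax; constructor. Qed.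

Lemma andEr (V : Type) (T : set (formula V)) f g : T |-- And f g -> T |-- g.
Proof. by apply: N2_mp; apply: N2_ax; constructor. Qed.

Lemma or_imp (V : Type) (T : set (formula V)) f g h :
  T |-- Imp f h -> T |-- Imp g h -> T |-- Imp (Or f g) h.
Proof.
by move=> fh; apply: N2_mp; apply: N2_mp fh; apply: N2_ax; constructor.
Qed.

Lemma botE (V : Type) (T : set (formula V)) f : T |-- Bot -> T |-- f.
Proof. by apply: N2_mp; apply: N2_ax; constructor. Qed.

Lemma neg_imp (V : Type) (T : set (formula V)) f g : T |-- Neg f -> T |-- Imp f g.
Proof. by move=> nf; apply: deduction; apply/botE/imp_mp. Qed.

Lemma tollens (V : Type) (T : set (formula V)) f g :
  T |-- Imp f g -> T |-- Neg g -> T |-- Neg f.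
Proof. exact: imp_trans. Qed.

Lemma tollens_imp (V : Type) (T : set (formula V)) f g :
  T |-- Imp f g -> T |-- Imp (Neg g) (Neg f).
Proof.
move=> fg; apply: deduction; apply: (@tollens _ _ f g); last by hyp.
exact: derives_U1.
Qed.

Lemma nn_mono (V : Type) (T : set (formula V)) f g :
  T |-- Imp f g -> T |-- Neg (Neg f) -> T |-- Neg (Neg g).
Proof. by move=> fg; apply: tollens; exact: tollens_imp. Qed.

Lemma nnI (V : Type) (T : set (formula V)) f : T |-- f -> T |-- Neg (Neg f).
Proof. by move=> Tf; apply: deduction; apply: (@N2_mp _ _ f); [hyp|exact: derives_U1]. Qed.

(** * Equivalence, plain and under negation *)

Definition eqv {V : Type} (T : set (formula V)) (f g : formula V) : Prop :=
  T |-- Imp f g /\ T |-- Imp g f.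

(** Equivalence as seen from inside a negation. It is weaker than [eqv], and it is what remains
    between x and F when only their double negations are known. *)
Definition neqv {V : Type} (T : set (formula V)) (f g : formula V) : Prop :=
  eqv T (Neg f) (Neg g).

Lemma eqv_refl (V : Type) (T : set (formula V)) f : eqv T f f.
Proof. by split; apply: imp_refl. Qed.

Lemma eqv_sym (V : Type) (T : set (formula V)) f g : eqv T f g -> eqv T g f.
Proof. by case. Qed.

Lemma eqv_axiom (V : Type) (T : set (formula V)) f g :
  N2_axiom (Iff f g) -> eqv T f g.
Proof. by move=> /(N2_ax T) fg; split; [apply: andEl fg|apply: andEr fg]. Qed.

Lemma eqv_neqv (V : Type) (T : set (formula V)) f g : eqv T f g -> neqv T f g.
Proof. by case=> fg gf; split; apply: tollens_imp. Qed.

Lemma eqv_and (V : Type) (T : set (formula V)) f f' g g' :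
  eqv T f f' -> eqv T g g' -> eqv T (And f g) (And f' g').
Proof.
have half f1 f2 g1 g2 : T |-- Imp f1 f2 -> T |-- Imp g1 g2 ->
    T |-- Imp (And f1 g1) (And f2 g2).
  move=> f12 g12; apply: deduction; apply: andI.
    apply: N2_mp (derives_U1 _ _ _ _ f12) _; apply: (@andEl _ _ _ g1); hyp.
  apply: N2_mp (derives_U1 _ _ _ _ g12) _; apply: (@andEr _ _ f1); hyp.
by case=> ? ? [? ?]; split; apply: half.
Qed.

Lemma eqv_or (V : Type) (T : set (formula V)) f f' g g' :
  eqv T f f' -> eqv T g g' -> eqv T (Or f g) (Or f' g').
Proof.
have half f1 f2 g1 g2 : T |-- Imp f1 f2 -> T |-- Imp g1 g2 ->
    T |-- Imp (Or f1 g1) (Or f2 g2).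
  move=> f12 g12; apply: or_imp.
    by apply: imp_trans f12 _; apply: N2_ax; constructor.
  by apply: imp_trans g12 _; apply: N2_ax; constructor.
by case=> ? ? [? ?]; split; apply: half.
Qed.

Lemma eqv_refuted (V : Type) (T : set (formula V)) f g :
  T |-- Neg f -> T |-- Neg g -> eqv T f g.
Proof. by split; apply: neg_imp. Qed.

Lemma neqv_nn (V : Type) (T : set (formula V)) f g :
  T |-- Neg (Neg f) -> T |-- Neg (Neg g) -> neqv T f g.
Proof. exact: eqv_refuted. Qed.

Lemma n_or (V : Type) (T : set (formula V)) f g :
  T |-- Neg f -> T |-- Neg g -> T |-- Neg (Or f g).
Proof. exact: or_imp. Qed.

Lemma n_andl (V : Type) (T : set (formula V)) f g :
  T |-- Neg f -> T |-- Neg (And f g).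
Proof. by apply: tollens; apply: N2_ax; constructor. Qed.

Lemma n_andr (V : Type) (T : set (formula V)) f g :
  T |-- Neg g -> T |-- Neg (And f g).
Proof. by apply: tollens; apply: N2_ax; constructor. Qed.

Lemma nn_and (V : Type) (T : set (formula V)) f g :
  T |-- Neg (Neg f) -> T |-- Neg (Neg g) -> T |-- Neg (Neg (And f g)).
Proof.
move=> nnf nng; apply: deduction.
apply: N2_mp (derives_U1 _ _ _ _ nnf) _; apply: deduction.
apply: N2_mp (derives_U1 _ _ _ _ (derives_U1 _ _ _ _ nng)) _; apply: deduction.
by apply: (@N2_mp _ _ (And f g)); [hyp|apply: andI; hyp].
Qed.

Lemma n_imp (V : Type) (T : set (formula V)) f g :
  T |-- Neg (Neg f) -> T |-- Neg g -> T |-- Neg (Imp f g).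
Proof.
move=> nnf ng; apply: deduction.
apply: N2_mp (derives_U1 _ _ _ _ nnf) _.
by apply: (@tollens _ _ _ g); [hyp|exact: derives_U1].
Qed.

(** Double negation commutes with conjunction, so the negation of a conjunction depends only on the
    negations of the conjuncts. *)
Lemma neqv_and (V : Type) (T : set (formula V)) f f' g g' :
  neqv T f f' -> neqv T g g' -> neqv T (And f g) (And f' g').
Proof.
have half f1 f2 g1 g2 : T |-- Imp (Neg f2) (Neg f1) ->
    T |-- Imp (Neg g2) (Neg g1) -> T |-- Imp (Neg (And f2 g2)) (Neg (And f1 g1)).
  move=> f12 g12; apply: deduction; apply: deduction.
  set U := _ `|` _.
  suff nn h k : T |-- Imp (Neg k) (Neg h) -> U |-- h -> U |-- Neg (Neg k).
    apply: (@N2_mp _ _ (Neg (And f2 g2))); last by hyp.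
    apply: nn_and; [apply: (nn f1) => //|apply: (nn g1) => //].
      by apply: (@andEl _ _ _ g1); hyp.
    by apply: (@andEr _ _ f1); hyp.
  move=> hk Uh; apply: (@tollens _ _ _ (Neg h)); last exact: nnI.
  by do 2!apply: derives_U1.
by case=> ? ? [? ?]; split; apply: half.
Qed.

Lemma neqv_or (V : Type) (T : set (formula V)) f f' g g' :
  neqv T f f' -> neqv T g g' -> neqv T (Or f g) (Or f' g').
Proof.
have half f1 f2 g1 g2 : T |-- Imp (Neg f2) (Neg f1) ->
    T |-- Imp (Neg g2) (Neg g1) -> T |-- Imp (Neg (Or f2 g2)) (Neg (Or f1 g1)).
  move=> f12 g12; apply: deduction.
  apply: n_or.
    apply: N2_mp (derives_U1 _ _ _ _ f12) _.
    apply: (@tollens _ _ _ (Or f2 g2)); last by hyp.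
    by apply: N2_ax; constructor.
  apply: N2_mp (derives_U1 _ _ _ _ g12) _.
  apply: (@tollens _ _ _ (Or f2 g2)); last by hyp.
  by apply: N2_ax; constructor.
by case=> ? ? [? ?]; split; apply: half.
Qed.

(** Obtained by reading [Neg Top] in two ways: the axiom on ~¬ makes [SNeg (Neg Top)] derivable, and
    the axiom on ~ of an implication extracts [SNeg Bot] from it. *)
Lemma snBot (V : Type) (T : set (formula V)) : T |-- SNeg Bot.
Proof.
have [_ top_sn] := @eqv_axiom V T _ _ (ax_snNeg Top).
have [sn_and _] := @eqv_axiom V T _ _ (ax_snImp Top Bot).
apply: (@andEr _ _ Top); apply: N2_mp sn_and _; apply: N2_mp top_sn _.
exact: imp_refl.
Qed.

(* The axiom ~a -> neg a extends from atoms to all formulas; substitution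
   needs this. *)
Lemma sn_neg (V : Type) (T : set (formula V)) f : T |-- Imp (SNeg f) (Neg f).
Proof.
elim: f => [a||f IHf g IHg|f IHf g IHg|f IHf g IHg|f IHf].
- by apply: N2_ax; constructor.
- exact/imp_const/imp_refl.
- apply: imp_trans (proj1 (eqv_axiom _ _ _ _ (ax_snAnd f g))) _.
  by apply: or_imp; [apply: imp_trans IHf _|apply: imp_trans IHg _];
    apply: tollens_imp; apply: N2_ax; constructor.
- apply: imp_trans (proj1 (eqv_axiom _ _ _ _ (ax_snOr f g))) _.
  apply: deduction; apply: n_or.
    by apply: N2_mp (derives_U1 _ _ _ _ IHf) _; apply: (@andEl _ _ _ (SNeg g)); hyp.
  by apply: N2_mp (derives_U1 _ _ _ _ IHg) _; apply: (@andEr _ _ (SNeg f)); hyp.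
- apply: imp_trans (proj1 (eqv_axiom _ _ _ _ (ax_snImp f g))) _.
  apply: deduction; apply: n_imp.
    by apply: nnI; apply: (@andEl _ _ _ (SNeg g)); hyp.
  by apply: N2_mp (derives_U1 _ _ _ _ IHg) _; apply: (@andEr _ _ f); hyp.
- apply: imp_trans (proj2 (eqv_axiom _ _ _ _ (ax_snSNeg f))) _.
  apply: deduction; apply: (@tollens _ _ _ (Neg f)); first exact: derives_U1.
  by apply: nnI; hyp.
Qed.

(** * Here-and-there models *)

(* [W false] is the world "here" and [W true] the world "there"; [s = false]
   means that the strong negation of the formula holds. *)
Fixpoint sat {V : Type} (W : bool -> set (formula V)) (w s : bool)
    (f : formula V) : Prop :=
  match f with
  | Atom a => W w (if s then Atom a else SNeg (Atom a))
  | Bot => ~~ s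
  | And g h => if s then sat W w s g /\ sat W w s h
               else sat W w s g \/ sat W w s h
  | Or g h => if s then sat W w s g \/ sat W w s h
              else sat W w s g /\ sat W w s h
  | Imp g h => if s then (sat W w true g -> sat W w true h) /\
                         (sat W true true g -> sat W true true h)
               else sat W w true g /\ sat W w false h
  | SNeg g => sat W w (~~ s) g
  end.

Lemma sat_there (V : Type) (W : bool -> set (formula V)) w s f :
  W false `<=` W true -> sat W w s f -> sat W true s f.
Proof.
move=> W01; case: w => //; elim: f s => /=.
- by move=> a s; apply: W01.
- by [].
- by move=> f IHf g IHg [] []; auto.
- by move=> f IHf g IHg [] []; auto.
- by move=> f IHf g IHg [] []; auto.
- by move=> f IHf s; apply: IHf.
Qed.

Lemma sat_total (V : Type) (W : bool -> set (formula V)) s f :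
  sat W true s f = sat (fun=> W true) true s f.
Proof.
by elim: f s => //= [f IHf g IHg|f IHf g IHg|f IHf g IHg] s; rewrite !IHf !IHg.
Qed.

Lemma sat_const (V : Type) (M : set (formula V)) w s f :
  sat (fun=> M) w s f = sat (fun=> M) true s f.
Proof.
elim: f s => //= [f IHf g IHg|f IHf g IHg|f IHf g IHg] s; rewrite !IHf !IHg //.
Qed.

Lemma soundness (V : Type) (W : bool -> set (formula V)) T f :
  W false `<=` W true -> consistent_lits (W true) ->
  (forall h w, T h -> sat W w true h) ->
  T |-- f -> forall w, sat W w true f.
Proof.
move=> W01 Wcons WT; elim=> [h Th w|h ax_h w|h g _ IHhg _ IHh w].
- exact: WT.
- have W0 k s : sat W false s k -> sat W true s k by exact: sat_there.
  have Ww a : ~ (W w (Atom a) /\ W w (SNeg (Atom a))).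
    by case: w => -[p q]; apply: (Wcons a); split; auto.
  case: ax_h => /=; try by move=> *; case: w Ww => Ww; intuition auto.
  + move=> a; split=> na; split=> pa; first by case: (Ww a).
    * by case: (Wcons a); split=> //; case: w na {Ww} => // /W01.
    * by case: (Wcons a).
    * by case: (Wcons a).
  (* With two worlds, either l fails there, hence everywhere, and its negation holds; or l holds
     there, and k → l can fail only here, where k would hold. *)
  + move=> k l; have [lt|nlt] := pselect (sat W true true l); last first.
      by right; right; split=> // lw; case: nlt; case: w lw {Ww} => // /W0.
    by have [|] := pselect (sat W w true k); [left|right; left].
- by have [+ _] := IHhg w; apply; apply: IHh.
Qed.

(** A truth table carried out inside the logic: each literal over [A] is either refuted or doubly
    negated, and every connective passes this status on, in agreement with the total model (M,
    M). *)
Lemma completion_decides (V : Type) (A : set V) (M T : set (formula V)) f :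
  (forall l, Lit A l -> ~ M l -> T |-- Neg l) ->
  (forall l, M l -> T |-- Neg (Neg l)) ->
  atoms f `<=` A ->
  if `[< sat (fun=> M) true true f >] then T |-- Neg (Neg f) else T |-- Neg f.
Proof.
move=> Mneg Mnn.
(* The induction runs over both signs: strong negation swaps them, and the strong falsity of an
   implication combines a positive premise with a negative conclusion. *)
suff decide s : atoms f `<=` A ->
  let f' := if s then f else SNeg f in
  if `[< sat (fun=> M) true s f >] then T |-- Neg (Neg f') else T |-- Neg f'.
  exact: (decide true).
have transfer h k P : eqv T h k ->
    (if `[< P >] then T |-- Neg (Neg k) else T |-- Neg k) ->
    (if `[< P >] then T |-- Neg (Neg h) else T |-- Neg h).
  by move=> [hk kh]; case: asboolP => _; [apply: nn_mono|apply: tollens].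
have dec_and h k P Q :
    (if `[< P >] then T |-- Neg (Neg h) else T |-- Neg h) ->
    (if `[< Q >] then T |-- Neg (Neg k) else T |-- Neg k) ->
    if `[< P /\ Q >] then T |-- Neg (Neg (And h k)) else T |-- Neg (And h k).
  rewrite asbool_and; case: asboolP => _ Th; case: asboolP => _ Tk /=;
    by [exact: nn_and|exact: n_andl|exact: n_andr].
have dec_or h k P Q :
    (if `[< P >] then T |-- Neg (Neg h) else T |-- Neg h) ->
    (if `[< Q >] then T |-- Neg (Neg k) else T |-- Neg k) ->
    if `[< P \/ Q >] then T |-- Neg (Neg (Or h k)) else T |-- Neg (Or h k).
  rewrite asbool_or; case: asboolP => _ Th; case: asboolP => _ Tk /=;
    by [exact: n_or|apply: nn_mono Th; apply: N2_ax; constructor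
       |apply: nn_mono Tk; apply: N2_ax; constructor].
elim: f s => [a||f IHf g IHg|f IHf g IHg|f IHf g IHg|f IHf] s fA /=.
- have la : Lit A (if s then Atom a else SNeg (Atom a)).
    by exists a; [exact: fA|case: s; [left|right]].
  by case: asboolP => Ml; [exact: Mnn|exact: Mneg].
- case: s; case: asboolP => //= _; first exact: imp_refl.
  exact/nnI/snBot.
- have {}IHf s' := IHf s' (fun a fa => fA a (or_introl fa)).
  have {}IHg s' := IHg s' (fun a ga => fA a (or_intror ga)).
  case: s => /=; first exact: dec_and (IHf true) (IHg true).
  apply: transfer (eqv_axiom _ _ _ _ (ax_snAnd f g)) _.
  exact: dec_or (IHf false) (IHg false).
- have {}IHf s' := IHf s' (fun a fa => fA a (or_introl fa)).
  have {}IHg s' := IHg s' (fun a ga => fA a (or_intror ga)).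
  case: s => /=; first exact: dec_or (IHf true) (IHg true).
  apply: transfer (eqv_axiom _ _ _ _ (ax_snOr f g)) _.
  exact: dec_and (IHf false) (IHg false).
- have {}IHf s' := IHf s' (fun a fa => fA a (or_introl fa)).
  have {}IHg s' := IHg s' (fun a ga => fA a (or_intror ga)).
  case: s => /=; last first.
    apply: transfer (eqv_axiom _ _ _ _ (ax_snImp f g)) _.
    exact: dec_and (IHf true) (IHg false).
  move: (IHf true) (IHg true) => /=; case: asboolP => Mf; case: asboolP => Mg Tf Tg.
  + by rewrite asboolT; [apply: nn_mono Tg; apply: N2_ax; constructor|tauto].
  + by rewrite asboolF; [exact: n_imp|tauto].
  + by rewrite asboolT; [apply: nn_mono Tg; apply: N2_ax; constructor|tauto].
  + by rewrite asboolT; [exact/nnI/neg_imp|tauto].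
- case: s => /=; first exact: (IHf false fA).
  by apply: transfer (IHf true fA); apply/eqv_sym/eqv_axiom; constructor.
Qed.

(** * Substitution *)

Fixpoint subst {V : Type} (sg : V -> formula V) (f : formula V) : formula V :=
  match f with
  | Atom a => sg a
  | Bot => Bot
  | And g h => And (subst sg g) (subst sg h)
  | Or g h => Or (subst sg g) (subst sg h)
  | Imp g h => Imp (subst sg g) (subst sg h)
  | SNeg g => SNeg (subst sg g)
  end.

(** Every axiom is a schema closed under substitution except ~a → ¬a, which is stated for atoms; its
    instances are supplied by [sn_neg]. *)
Lemma derives_subst (V : Type) (sg : V -> formula V) (S T : set (formula V)) f :
  (forall h, S h -> T |-- subst sg h) -> S |-- f -> T |-- subst sg f.
Proof.
move=> ST; elim=> [h /ST//|h ax_h|h g _ IHhg _ IHh]; last exact: N2_mp IHhg IHh.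
case: ax_h => *; try by apply: N2_ax; constructor.
exact: sn_neg.
Qed.

Lemma subst_id (V : Type) (sg : V -> formula V) f :
  (forall a, atoms f a -> sg a = Atom a) -> subst sg f = f.
Proof.
elim: f => //= [a|f IHf g IHg|f IHf g IHg|f IHf g IHg|f IHf] sgE.
- exact: sgE.
- by rewrite IHf ?IHg => // a ?; apply: sgE; [right|left].
- by rewrite IHf ?IHg => // a ?; apply: sgE; [right|left].
- by rewrite IHf ?IHg => // a ?; apply: sgE; [right|left].
- by rewrite IHf.
Qed.

(** Bodies contain no implication besides [Top] and negations, and [neqv] formulas have equivalent
    negations by definition, so the induction never needs more than [neqv] at the leaves. *)
Lemma subst_body_neqv (V : Type) (sg : V -> formula V) (T : set (formula V)) G :
  (forall l, literal l -> neqv T l (subst sg l)) ->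
  body G -> neqv T G (subst sg G).
Proof.
move=> lit; elim=> [l /lit//|||f g _ IHf _ IHg|f g _ IHf _ IHg|f _ IHf] /=.
- exact: eqv_refl.
- exact: eqv_refl.
- exact: neqv_and.
- exact: neqv_or.
- exact: eqv_neqv.
Qed.

Definition only_under_neg {V : Type} (x f : formula V) : Prop :=
  forall p, occurrence x f p -> under_neg f p.

(** When f is not a negation, the negation that covers an occurrence inside g cannot start at the
    root of f, so it already lies inside g. *)
Lemma only_under_neg_sub (V : Type) (x f g : formula V) i :
  (forall G, f <> Neg G) -> onth (immediate_subformulas f) i = Some g ->
  only_under_neg x f -> only_under_neg x g.
Proof.
move=> f_neg fi xf p xp.
have [|[|j q] [G []]] := xf (i :: p); first by rewrite /occurrence /= fi.
  by move=> _ [/f_neg].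
by rewrite /= => /andP[/eqP-> qp]; rewrite fi => qG; exists q, G.
Qed.

Lemma only_under_neg_neq (V : Type) (x l : formula V) :
  literal x -> only_under_neg x l -> l <> x.
Proof.
move=> x_lit xl lx; have [|[|j q] [G [//= _ [lG]]]] := xl [::]; first by rewrite lx.
by case: x_lit => a _ []; rewrite -lx lG.
Qed.

(** Above the negations no leaf is x, so the leaves there are replaced by equivalents; at the first
    negation the weaker [neqv] takes over through [subst_body_neqv]. *)
Lemma subst_body_eqv (V : Type) (sg : V -> formula V) (T : set (formula V)) x G :
  literal x ->
  (forall l, literal l -> neqv T l (subst sg l)) ->
  (forall l, literal l -> l <> x -> eqv T l (subst sg l)) ->
  body G -> only_under_neg x G -> eqv T G (subst sg G).
Proof.
move=> x_lit nlit lit; elim=> [l l_lit|||f g _ IHf _ IHg|f g _ IHf _ IHg|f f_body _] xG /=.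
- exact/lit/(only_under_neg_neq _ _ _ x_lit xG).
- exact: eqv_refl.
- exact: eqv_refl.
- apply: eqv_and; [apply: IHf; apply: (only_under_neg_sub _ _ _ _ 0) xG
    |apply: IHg; apply: (only_under_neg_sub _ _ _ _ 1) xG]; by [].
- apply: eqv_or; [apply: IHf; apply: (only_under_neg_sub _ _ _ _ 0) xG
    |apply: IHg; apply: (only_under_neg_sub _ _ _ _ 1) xG]; by [].
- exact: subst_body_neqv.
Qed.

(** The head of a rule is not under a negation: the rule itself is not one, since its head is a
    literal and not [Bot]. *)
Lemma head_neq (V : Type) (x G l : formula V) :
  literal x -> literal l -> only_under_neg x (Imp G l) -> l <> x.
Proof.
move=> x_lit l_lit xGl; apply: only_under_neg_neq => //.
apply: (only_under_neg_sub _ _ _ _ 1) xGl => // H [_ lB].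
by case: l_lit => a _ []; rewrite lB.
Qed.

(** * Answer sets *)

Lemma sat_literal (V : Type) (W : bool -> set (formula V)) w l :
  literal l -> sat W w true l <-> W w l.
Proof. by case=> a _ [] ->. Qed.

Lemma completion_neg (V : Type) (B : set V) (T M : set (formula V)) l :
  Lit B l -> ~ M l -> completion B T M |-- Neg l.
Proof. by move=> Bl Ml; apply: N2_hyp; left; right; exists l. Qed.

Lemma completion_nn (V : Type) (B : set V) (T M : set (formula V)) l :
  M l -> completion B T M |-- Neg (Neg l).
Proof. by move=> Ml; apply: N2_hyp; right; exists l. Qed.

Lemma completion_decidesE (V : Type) (B : set V) (T M : set (formula V)) f :
  atoms f `<=` B ->
  if `[< sat (fun=> M) true true f >] then completion B T M |-- Neg (Neg f)
  else completion B T M |-- Neg f.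
Proof.
apply: completion_decides => l; [exact: completion_neg|exact: completion_nn].
Qed.

(** If f failed in the total model (M, M), the completion would refute f by [completion_decidesE],
    against consistency. *)
Lemma consistent_completion_sat (V : Type) (B : set V) (T M : set (formula V)) f :
  N2_consistent (completion B T M) -> atoms f `<=` B ->
  completion B T M |-- f -> sat (fun=> M) true true f.
Proof.
move=> Tcons /(completion_decidesE _ _ T M); case: asboolP => // _ nf Tf.
by case: Tcons; apply: N2_mp nf Tf.
Qed.

(** The formulas ¬l and ¬¬l added by the completion are settled by the world there, which is M
    itself; hence any [H] below M may serve as the world here as soon as [T] holds. *)
Lemma completion_sound (V : Type) (B : set V) (T H M : set (formula V)) f :
  M `<=` Lit B -> consistent_lits M -> H `<=` M ->
  let W w := if w then M else H in
  (forall h w, T h -> sat W w true h) ->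
  completion B T M |-- f -> forall w, sat W w true f.
Proof.
move=> MB Mcons HM W WT; apply: soundness => // h w [[Th|]|].
- exact: WT.
- move=> [l [[a Ba la] Ml] <-] /=.
  have l_lit : literal l by exists a.
  by split=> /(sat_literal _ _ _ _ l_lit) //; case: w => // /HM.
- move=> [l Ml <-] /=; have [a Ba la] := MB _ Ml.
  have l_lit : literal l by exists a.
  have Wl : sat W true true l by apply/sat_literal.
  by split=> -[_ /(_ Wl)].
Qed.

Lemma answer_set_supported (V : Type) (B : set V) (P M : set (formula V))
    (x F : formula V) :
  program P -> over_atoms B P -> atoms F `<=` B -> atoms x `<=` B ->
  literal x -> (forall f, P f -> only_under_neg x f) ->
  answer_set B (P `|` [set Imp F x]) M -> M x -> sat (fun=> M) true true F.
Proof.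
move=> [_ P_rules] PB FB xB x_lit xP [MB Mcons Tcons TM] Mx.
apply: contrapT => MF.
pose W w : set (formula V) := if w then M else M `\ x.
have W_M f : sat W true true f <-> sat (fun=> M) true true f by rewrite sat_total.
have W01 : W false `<=` W true by move=> l [].
(* By soundness the derivation of x would force x at both worlds, but x has been removed here. *)
suff /(_ false) : forall w, sat W w true x.
  by move=> /(sat_literal _ _ _ _ x_lit) [_ /(_ erefl)].
apply: (completion_sound _ _ _ (M `\ x) _ _ MB) (TM _ Mx) => // h w [Ph|->]; last first.
  by split=> /sat_there; rewrite -/W => /(_ W01)/W_M.
have /consistent_completion_sat : completion B (P `|` [set Imp F x]) M |-- h.
  by apply: N2_hyp; left; left; left.
move=> /(_ Tcons (PB _ Ph)) Mh.
have [G [l [_ l_lit h_eq]]] := P_rules _ Ph; rewrite {}h_eq in Ph Mh *.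
have lx : l <> x by apply: head_neq (xP _ Ph).
(* A body that holds at either world holds there, which puts the head in M; as the head differs from
   x, it survives the removal. *)
have Ml : sat W true true G -> M l.
  by move=> /W_M MG; case: Mh => _ /(_ MG) /sat_literal; apply.
rewrite -/W; split; last by move=> /Ml ?; apply/sat_literal.
move=> /(sat_there _ _ _ _ _ W01) /Ml Ml'; apply/sat_literal => //.
by case: w.
Qed.

Lemma completion_iff_derives (V : Type) (B : set V) (P M : set (formula V))
    (x F : formula V) :
  program P -> literal x -> (forall f, P f -> only_under_neg x f) ->
  atoms x `<=` B -> (forall a, atoms F a -> ~ atoms x a) ->
  M `<=` Lit B -> consistent_lits M -> M x ->
  completion B (P `|` [set Imp F x]) M |-- Neg (Neg F) ->
  forall l, literal l -> completion B (P `|` [set Iff x F]) M |-- l ->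
  completion B (P `|` [set Imp F x]) M |-- l.
Proof.
move=> [_ P_rules] x_lit xP xB Fx MB Mcons Mx.
set T := completion B (P `|` [set Imp F x]) M => nnF.
have TP h : P h -> T |-- h by move=> Ph; apply: N2_hyp; left; left; left.
have TFx : T |-- Imp F x by apply: N2_hyp; left; left; right.
have nnx : T |-- Neg (Neg x) by apply: completion_nn.
have [a [s xE]] : exists a s, x = if s then Atom a else SNeg (Atom a).
  by case: x_lit => a _ [] ->; exists a; [exists true|exists false].
have xa : atoms x a by rewrite xE; case: (s).
(* The atom of x is replaced so that x itself becomes F up to equivalence: for x = ~a, the atom a
   goes to ~F and x to ~~F. *)
pose sg v := if pselect (v = a) then if s then F else SNeg F else Atom v.
have sga : sg a = if s then F else SNeg F by rewrite /sg; case: pselect.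
have sgN v : v <> a -> sg v = Atom v by rewrite /sg; case: pselect.
have sgF : subst sg F = F.
  by apply: subst_id => b Fb; apply: sgN => ba; apply: Fx Fb _; rewrite ba.
have sgx : eqv T (subst sg x) F.
  rewrite xE; case: (s) sga => /= ->; first exact: eqv_refl.
  by apply/eqv_sym/eqv_axiom; constructor.
(* The complement of x is also affected by [sg]. It is refuted since M is consistent and contains x,
   and its image ~F is refuted by the double negation of F, so the two are trivially equivalent. *)
pose y := if s then SNeg (Atom a) else Atom a.
have ny : T |-- Neg y.
  apply: completion_neg; first by exists a; [exact: xB|rewrite /y; case: (s); [right|left]].
  by move: Mx; rewrite xE /y; case: (s) => ? ?; apply: (Mcons a).
have sgy : subst sg y = SNeg F by rewrite /y; case: (s) sga => /= ->.
have nsgy : T |-- Neg (subst sg y) by rewrite sgy; apply: tollens (sn_neg _ _ _) nnF.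
have lit l : literal l -> l <> x -> eqv T l (subst sg l).
  move=> l_lit lx; have [->|ly] := pselect (l = y); first exact: eqv_refuted.
  rewrite subst_id; first exact: eqv_refl.
  case: l_lit => b _ lE c; have [ba|ba] := pselect (b = a).
    by move: lx ly lE; rewrite xE /y ba; case: (s) => ? ? [].
  by case: lE => -> /= ->; apply: sgN.
have nlit l : literal l -> neqv T l (subst sg l).
  move=> l_lit; have [->|lx] := pselect (l = x); last exact/eqv_neqv/lit.
  by apply: neqv_nn => //; apply: nn_mono nnF; case: sgx.
(* The substitution turns x ↔ F into a derivable equivalence of F with itself, and turns every other
   hypothesis into a consequence of [T]. *)
move=> l l_lit Tl; have : T |-- subst sg l.
  apply: derives_subst Tl => h [[[Ph|->]|]|].
  - have [G [k [G_body k_lit h_eq]]] := P_rules _ Ph; rewrite {}h_eq in Ph *.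
    have [_ sgG] : eqv T G (subst sg G).
      apply: subst_body_eqv x_lit nlit lit G_body _.
      apply: (only_under_neg_sub _ _ _ _ 0) (xP _ Ph) => // H [_ kB].
      by case: k_lit => b _ []; rewrite kB.
    have [sgk _] := lit k k_lit (head_neq _ _ _ _ x_lit k_lit (xP _ Ph)).
    exact: imp_trans sgG (imp_trans _ _ _ _ _ (TP _ Ph) sgk).
  - by rewrite /= sgF; case: sgx => ? ?; apply: andI.
  - move=> [k [[b Bb kE] Mk] <-] /=.
    have [kN _] := nlit k (ex_intro2 _ _ b I kE).
    by apply: N2_mp kN _; apply: completion_neg => //; exists b.
  - move=> [k Mk <-] /=; have [b Bb kE] := MB _ Mk.
    have [_ kN] := nlit k (ex_intro2 _ _ b I kE).
    by apply: tollens kN _; apply: completion_nn.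
(* For l = x the substituted derivation yields F, and the rule x ← F gives back x. *)
have [->|lx] := pselect (l = x); last by apply: N2_mp; case: (lit l l_lit lx).
by move=> Tx; apply: N2_mp TFx _; apply: N2_mp Tx; case: sgx.
Qed.

Theorem theorem2p5 (V : Type) (A FA : set V) (P : set (formula V))
    (x F : formula V)
    (P_program : program P) (P_over : over_atoms A P)
    (x_literal : literal x)
    (x_under_neg : forall f p, P f -> occurrence x f p -> under_neg f p)
    (F_over : atoms F `<=` FA) (FA_sub : Lit FA `<=` Lit A)
    (x_notin : ~ Lit FA x) :
  forall M : set (formula V),
    answer_set (A `|` atoms x) (P `|` [set Imp F x]) M <->
    answer_set (A `|` atoms x) (P `|` [set Iff x F]) M.
Proof.
move=> M.
set B := A `|` atoms x.
have F_A : atoms F `<=` A.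
  move=> a /F_over Fa.
  by have [|b Ab [[->//]|//]] := FA_sub (Atom a); first by exists a => //; left.
have F_B : atoms F `<=` B by move=> a /F_A; left.
have x_B : atoms x `<=` B by right.
have x_only f : P f -> only_under_neg x f by move=> Pf p; apply: x_under_neg.
have P_B : over_atoms B P by move=> f /P_over fA a /fA; left.
(* [Lit FA] contains both literals of each atom of [FA], so excluding x excludes its atom; this is
   what keeps F fixed under the substitution. *)
have F_x a : atoms F a -> ~ atoms x a.
  move=> /F_over Fa xa; apply: x_notin; case: x_literal xa => b _ xE.
  by case: xE => -> /= ab; exists a => //; rewrite ab; [left|right].
have iff_imp h : completion B (P `|` [set Imp F x]) M h ->
    completion B (P `|` [set Iff x F]) M |-- h.
  move=> [[[Ph|->]|hN]|hM]; [|apply: (@andEr _ _ (Imp x F))|..]; apply: N2_hyp.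
  - by left; left; left.
  - by left; left; right.
  - by left; right.
  - by right.
split=> [MP|[MB Mcons Tcons TM]].
  (* Derivations carry over to the stronger program, so only consistency is at stake. It holds
     because (M, M) is a model: supportedness of x gives the missing implication x → F. *)
  have [MB Mcons Tcons TM] := MP; split=> // [Tbot|l /TM]; last exact: derives_cut.
  have hyp_sat h : atoms h `<=` B -> (P `|` [set Imp F x]) h ->
      sat (fun=> M) true true h.
    move=> hB Ph; apply: consistent_completion_sat Tcons hB _.
    by apply: N2_hyp; left; left.
  have [Fx _] : sat (fun=> M) true true (Imp F x).
    by apply: hyp_sat; [rewrite /= subUset|right].
  have xF : sat (fun=> M) true true x -> sat (fun=> M) true true F.
    move=> /(sat_literal _ _ _ _ x_literal).
    exact: (answer_set_supported _ _ _ _ _ _ P_program P_B F_B x_B x_literal x_only MP).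
  have := completion_sound _ B _ M M _ MB Mcons (fun _ => id) _ Tbot true.
  have -> : (fun w : bool => if w then M else M) = fun=> M.
    by apply/funext => -[].
  move=> sound; suff : sat (fun=> M) true true (@Bot V) by [].
  apply: sound => h w; have -> : sat (fun=> M) w true h = sat (fun=> M) true true h.
    exact: sat_const.
  by move=> [Ph|->]; [apply: hyp_sat (P_B _ Ph) _; left|].
have Tsub h : completion B (P `|` [set Imp F x]) M |-- h ->
    completion B (P `|` [set Iff x F]) M |-- h by exact: derives_cut.
split=> // [/Tsub//|l Ml]; have [b _ lE] := MB _ Ml.
have l_lit : literal l by exists b.
have [Mx|Mx] := pselect (M x).
  apply: completion_iff_derives (TM _ Ml) => //.
  (* F is decided up to double negation; were it refuted, x → F would refute x, whose double
     negation is in the completion. *)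
  move: (completion_decidesE _ _ (P `|` [set Imp F x]) M _ F_B).
  case: asboolP => // _ /Tsub nF; case: Tcons.
  apply: N2_mp (completion_nn _ _ _ _ _ Mx) _; apply: tollens nF.
  by apply: (@andEl _ _ _ (Imp F x)); apply: N2_hyp; left; left; right.
(* When x is not in M, the completion contains ¬x, so x → F comes for free. *)
apply: derives_cut (TM _ Ml) => h [[[Ph|->]|hN]|hM].
- by apply: N2_hyp; do 3!left.
- apply: andI; last by apply: N2_hyp; left; left; right.
  apply: neg_imp; apply: completion_neg => //.
  by case: x_literal => c _ xE; exists c => //; right; case: xE => ->.
- by apply: N2_hyp; left; right.
- by apply: N2_hyp; right.
Qed.
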